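(* Let $R$ be a ring. The following statements are equivalent: (1) $\overline{\mathbb{P}}_{\mathrm{rad}}=\mathbb{S}_{\mathrm{rad}}$. (2) $R$ is a left $V$-ring.
   Context: $R$ is an associative ring with identity; modules are left $R$-modules. $\mathrm{rad}$ is the preradical assigning to each module $M$ its Jacobson radical $\mathrm{rad}(M)$, the intersection of all maximal submodules of $M$ (equal to $M$ if there are none). $\mathbb{T}_{\mathrm{rad}}=\{M\mid\mathrm{rad}(M)=M\}$. $\overline{\mathbb{P}}_{\mathrm{rad}}$ is the class consisting of the zero module and all nonzero modules $M$ that are $\mathrm{rad}$-co-first, i.e. either $M\in\mathbb{T}_{\mathrm{rad}}$ or $M$ has no nonzero quotient in $\mathbb{T}_{\mathrm{rad}}$. $\mathbb{S}_{\mathrm{rad}}$ is the class consisting of the zero module and all nonzero modules $M$ that are $\mathrm{rad}$-second, i.e. $\mathrm{rad}(M)=0$ or $\mathrm{rad}(M)=M$. $R$ is a left $V$-ring if every simple left $R$-module is injective. *)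

(* Defs.v *)
From mathcomp Require Import all_boot all_algebra.
From mathcomp Require Import classical_sets.

Set Implicit Arguments.
Unset Strict Implicit.
Unset Printing Implicit Defensive.

Import GRing.Theory.

Local Open Scope classical_set_scope.
Local Open Scope ring_scope.

(* Submodules are classical sets, so they need not be decidable; [[in N]] is the
   boolean predicate that [boolp] attaches to the set [N]. *)
Definition submodule (R : pzRingType) (M : lmodType R) (N : set M) : Prop :=
  GRing.submod_closed [in N].

Definition zero_module (R : pzRingType) (M : lmodType R) : Prop :=
  forall x : M, x = 0.

Definition maximal_submodule (R : pzRingType) (M : lmodType R) (N : set M) :
    Prop :=
  [/\ submodule N, N <> setT &
      forall K : set M, submodule K -> N `<=` K -> K = N \/ K = setT].

(* An empty [\bigcap] is [setT], so [rad M] is all of [M] when [M] has no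
   maximal submodule. *)
Definition rad (R : pzRingType) (M : lmodType R) : set M :=
  \bigcap_(N in @maximal_submodule R M) N.

Arguments rad {R} M _.

Definition T_rad (R : pzRingType) (M : lmodType R) : Prop := rad M = setT.

(* Quotients of [M] are taken up to isomorphism: [Q] is a quotient of [M] when
   [M] maps linearly onto [Q]. *)
Definition quotient_of (R : pzRingType) (M Q : lmodType R) : Prop :=
  exists p : {linear M -> Q}, forall y : Q, exists x : M, p x = y.

Definition rad_co_first (R : pzRingType) (M : lmodType R) : Prop :=
  T_rad M \/
  ~ (exists Q : lmodType R, [/\ quotient_of M Q, ~ zero_module Q & T_rad Q]).

Definition rad_second (R : pzRingType) (M : lmodType R) : Prop :=
  rad M = [set 0] \/ rad M = setT.

Definition Pbar_rad (R : pzRingType) (M : lmodType R) : Prop :=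
  zero_module M \/ (~ zero_module M /\ rad_co_first M).

Definition S_rad (R : pzRingType) (M : lmodType R) : Prop :=
  zero_module M \/ (~ zero_module M /\ rad_second M).

Definition simple_module (R : pzRingType) (M : lmodType R) : Prop :=
  ~ zero_module M /\
  forall N : set M, submodule N -> N = [set 0] \/ N = setT.

Definition injective_module (R : pzRingType) (E : lmodType R) : Prop :=
  forall (A B : lmodType R) (i : {linear A -> B}) (f : {linear A -> E}),
    injective i -> exists g : {linear B -> E}, forall x : A, g (i x) = f x.

Definition left_V_ring (R : pzRingType) : Prop :=
  forall M : lmodType R, simple_module M -> injective_module M.

(* Main.v *)
From HB Require Import structures.
From mathcomp Require Import all_boot all_algebra.
From mathcomp Require Import boolp classical_sets.
Require Import Defs.

(** The two classes are compared through the condition that every module has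
    zero radical, which turns out to characterise left V-rings.

    Call a submodule [N] of [M] maximal avoiding [x] when it is maximal among
    the submodules not containing [x]; Zorn's lemma provides such an [N] above
    any submodule that misses [x].  The image of [x] then lies in every nonzero
    submodule of [M / N], so it generates an essential simple submodule.  The
    argument turns on the property [avoiding_cofull R]: that simple submodule is
    always the whole of [M / N], i.e. [M = N + R x].

    - In a V-ring the essential simple submodule is injective, hence a direct
      summand, hence everything ([avoiding_cofull_of_V_ring]).
    - Under [avoiding_cofull R] a submodule maximal avoiding [x] is a maximal
      submodule, so every [x <> 0] is missed by a maximal submodule and all
      radicals vanish ([rad_eq0]).  Then only the zero module is its own
      radical, and both classes contain all modules.
    - Conversely, a cyclic module equal to its radical is zero, and quotients of
      cyclic modules are cyclic, so cyclic modules are always co-first; if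
      co-first modules are second, cyclic modules have zero radical.  Given
      [b] outside [N], a maximal submodule of the cyclic module generated by
      the class of [b] that misses the class of [x] must be zero, because the
      class of [x] lies in every nonzero submodule of [M / N]; thus that cyclic
      module is simple and [b] belongs to [N + R x]
      ([avoiding_cofull_of_cyclic_rad0]).
    - Finally [avoiding_cofull R] makes simple modules injective
      ([V_ring_of_avoiding_cofull]): to extend a nonzero [f : A -> S] along
      [i : A -> B], choose [N] above [i (ker f)] maximal avoiding some [i a]
      with [f a <> 0]; then [B = N + i A], and [f] extends by zero on [N]. *)

Set Implicit Arguments.
Unset Strict Implicit.
Unset Printing Implicit Defensive.

Import GRing.Theory.

Local Open Scope classical_set_scope.
Local Open Scope ring_scope.

(** * Submodules *)

Section Submodules.
Variables (R : pzRingType) (M : lmodType R).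
Implicit Types (N K : set M) (x y : M).

Lemma submoduleP N :
  submodule N <-> N 0 /\ forall r x y, N x -> N y -> N (r *: x + y).
Proof.
split=> [[/set_mem N0 NL]|[N0 NL]].
  by split=> // r x y Nx Ny; apply/set_mem/NL; rewrite inE.
by split=> [|r x y]; rewrite !inE //; apply: NL.
Qed.

Lemma submodule0 N : submodule N -> N 0.
Proof. by case/submoduleP. Qed.

Lemma submoduleL N r x y : submodule N -> N x -> N y -> N (r *: x + y).
Proof. by case/submoduleP=> _; apply. Qed.

Lemma submoduleZ N r x : submodule N -> N x -> N (r *: x).
Proof.
by move=> sN Nx; rewrite -[_ *: _]addr0; apply: submoduleL (submodule0 _).
Qed.

Lemma submoduleB N x y : submodule N -> N x -> N y -> N (x - y).
Proof. by move=> sN Nx Ny; rewrite addrC -scaleN1r; apply: submoduleL. Qed.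

Lemma submodule_set0 : submodule [set 0 : M].
Proof.
by apply/submoduleP; split=> // r _ _ -> ->; rewrite scaler0 addr0.
Qed.

Definition adjoin N x : set M := [set m | exists r, N (m - r *: x)].

Lemma submodule_adjoin N x : submodule N -> submodule (adjoin N x).
Proof.
move=> sN; apply/submoduleP; split=> [|r m m' [s Ns] [s' Ns']].
  by exists 0; rewrite scale0r subr0; apply: submodule0.
exists (r * s + s').
suff -> : r *: m + m' - (r * s + s') *: x
        = r *: (m - s *: x) + (m' - s' *: x) by apply: submoduleL.
by rewrite scalerDl -scalerA scalerBr opprD addrACA.
Qed.

Lemma sub_adjoin N x : N `<=` adjoin N x.
Proof. by move=> y Ny; exists 0; rewrite scale0r subr0. Qed.

Lemma mem_adjoin N x : submodule N -> adjoin N x x.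
Proof. by move=> sN; exists 1; rewrite scale1r subrr; apply: submodule0. Qed.

Lemma adjoin_sub N K x :
  submodule K -> N `<=` K -> K x -> adjoin N x `<=` K.
Proof.
move=> sK NK Kx m [r Nm]; rewrite -[m](subrK (r *: x)) addrC.
by apply: submoduleL (NK _ Nm).
Qed.

Lemma rad0_nonmem : rad M = [set 0] -> forall x, x <> 0 ->
  exists2 L, maximal_submodule L & ~ L x.
Proof.
move=> rM x xn0; apply: contrapT => noL; apply: xn0.
suff: rad M x by rewrite rM.
by move=> L maxL; apply: contrapT => nLx; apply: noL; exists L.
Qed.

End Submodules.

(** * Submodules maximal avoiding an element *)

Section Avoiding.
Variables (R : pzRingType) (M : lmodType R).
Implicit Types (N K : set M) (x y : M).

Definition maximal_avoiding x N : Prop :=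
  [/\ submodule N, ~ N x &
      forall K, submodule K -> N `<=` K -> ~ K x -> K = N].

Lemma exists_maximal_avoiding N0 x : submodule N0 -> ~ N0 x ->
  exists2 N, N0 `<=` N & maximal_avoiding x N.
Proof.
move=> sN0 nN0x.
(* The union with [N0] gives the empty chain the upper bound [N0]. *)
pose P (A : set M) := submodule (N0 `|` A) /\ ~ (N0 `|` A) x.
have [F FP Ftot|A [[sA nAx] Amax]] := @Zorn_bigcup _ P.
  split; last first.
    by case=> // -[X FX Xx]; have [_] := FP _ FX; apply; right.
  have step X r u v : F X -> (N0 `|` X) u -> (N0 `|` X) v ->
      (N0 `|` \bigcup_(Y in F) Y) (r *: u + v).
    move=> FX Xu Xv; have [sX _] := FP _ FX.
    by have [|?] := submoduleL r sX Xu Xv; [left|right; exists X].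
  apply/submoduleP; split=> [|r u v]; first by left; apply: submodule0.
  move=> [N0u|[X FX Xu]] [N0v|[Y FY Yv]].
  - by left; apply: submoduleL.
  - by apply: step FY _ _; [left|right].
  - by apply: step FX _ _; [right|left].
  - have [XY|YX] := Ftot _ _ FX FY.
      by apply: step FY _ _; right=> //; apply: XY.
    by apply: step FX _ _; right=> //; apply: YX.
exists (N0 `|` A); first by move=> y; left.
split=> // K sK NK nKx; rewrite eqEsubset; split=> //.
have AK : A `<=` K by move=> y Ay; apply: NK; right.
have N0K : N0 `|` K = K.
  by apply/setUidPr => y N0y; apply: NK; left.
apply: contrapT => nKA; apply: (Amax K); last by rewrite /P N0K.
split=> // KA.
by apply: nKA => y Ky; right; apply: KA.
Qed.

(** This is the essentiality of the image of [x] in [M / N]. *)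
Lemma maximal_avoiding_essential N x b : maximal_avoiding x N -> ~ N b ->
  adjoin N b x.
Proof.
move=> [sN nNx maxN] nNb; apply: contrapT => nx; apply: nNb.
rewrite -(maxN (adjoin N b)) //; first exact: mem_adjoin.
- exact: submodule_adjoin.
- exact: sub_adjoin.
Qed.

Lemma maximal_of_avoiding N x : maximal_avoiding x N ->
  (forall b, adjoin N x b) -> maximal_submodule N.
Proof.
move=> [sN nNx maxN] full; split=> // [NT|K sK NK].
  by apply: nNx; rewrite NT.
have [Kx|nKx] := pselect (K x); last by left; apply: maxN.
right; rewrite -subTset => b _; exact: (adjoin_sub sK NK Kx (full b)).
Qed.

End Avoiding.

Definition avoiding_cofull (R : pzRingType) : Prop :=
  forall (M : lmodType R) (N : set M) (x : M),
    maximal_avoiding x N -> forall b, adjoin N x b.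

Lemma rad_eq0 (R : pzRingType) (M : lmodType R) :
  avoiding_cofull R -> rad M = [set 0].
Proof.
move=> cofull; rewrite eqEsubset; split=> [x radx|_ -> N [sN _ _]]; last first.
  exact: submodule0.
apply: contrapT => xn0.
have [N _ maxN] := exists_maximal_avoiding (@submodule_set0 R M) xn0.
have [_ nNx _] := maxN; apply: nNx.
apply: radx; exact: maximal_of_avoiding maxN (cofull _ _ _ maxN).
Qed.

(** * Quotient modules and maps given by their graph *)

Section QuotientModule.
Variables (R : pzRingType) (M : lmodType R) (N : set M) (sN : submodule N).
Local Open Scope quotient_scope.

(** The proof argument lets canonical structures find the closure properties. *)
Definition submodule_pred (_ : submodule N) : {pred M} := [in N].

HB.instance Definition _ := GRing.isZmodClosed.Build M (submodule_pred sN)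
  (GRing.submod_closedB sN).

Definition quot_module : Type := Quotient.quot (submodule_pred sN).

HB.instance Definition _ := Quotient.on quot_module.
HB.instance Definition _ := GRing.Zmodule.on quot_module.

Definition quot_pi (m : M) : quot_module := \pi_quot_module m.

Lemma quot_piK q : quot_pi (repr q) = q.
Proof. exact: reprK. Qed.

Lemma quot_pi_eq m m' : quot_pi m = quot_pi m' <-> N (m - m').
Proof.
split=> [/eqP|Nm].
  by rewrite -[_ == _]Quotient.idealrBE => /set_mem.
by apply/eqP; rewrite -[_ == _]Quotient.idealrBE; apply: mem_set.
Qed.

Fact quot_pi_zmod_morphism : zmod_morphism quot_pi.
Proof. exact: (raddfB \pi_(Quotient.quot (submodule_pred sN))). Qed.

HB.instance Definition _ :=
  GRing.isZmodMorphism.Build M quot_module quot_pi quot_pi_zmod_morphism.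

Definition quot_scale r (q : quot_module) := quot_pi (r *: repr q).

Lemma quot_scale_pi r m : quot_scale r (quot_pi m) = quot_pi (r *: m).
Proof.
apply/quot_pi_eq; rewrite -scalerBr.
by apply: submoduleZ => //; apply/quot_pi_eq; rewrite quot_piK.
Qed.

Fact quot_scalerA a b q : quot_scale a (quot_scale b q) = quot_scale (a * b) q.
Proof. by rewrite -[q]quot_piK !quot_scale_pi scalerA. Qed.

Fact quot_scale1r : left_id 1 quot_scale.
Proof. by move=> q; rewrite -[q]quot_piK quot_scale_pi scale1r. Qed.

Fact quot_scalerDr : right_distributive quot_scale +%R.
Proof.
move=> r q q'; rewrite -[q]quot_piK -[q']quot_piK.
by rewrite -raddfD !quot_scale_pi scalerDr raddfD.
Qed.

Fact quot_scalerDl q : {morph quot_scale^~ q : a b / a + b}.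
Proof.
by move=> a b; rewrite -[q]quot_piK !quot_scale_pi scalerDl raddfD.
Qed.

HB.instance Definition _ := GRing.Zmodule_isLmodule.Build R quot_module
  quot_scalerA quot_scale1r quot_scalerDr quot_scalerDl.

Fact quot_pi_scalable : scalable quot_pi.
Proof. by move=> r m; rewrite -quot_scale_pi. Qed.

HB.instance Definition _ :=
  GRing.isScalable.Build R M quot_module *:%R quot_pi quot_pi_scalable.

Lemma exists_quotient : exists (Q : lmodType R) (p : {linear M -> Q}),
  (forall y, exists x, p x = y) /\ forall x, p x = 0 <-> N x.
Proof.
exists quot_module, quot_pi; split=> [q|x].
  by exists (repr q); apply: quot_piK.
by rewrite -(raddf0 quot_pi) quot_pi_eq subr0.
Qed.

End QuotientModule.

(** A map defined through choices (of a preimage, or of a decomposition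
    [b = n + i a]) is single-valued and linear as soon as its graph is stable
    under linear combinations and meets [0] x [B] trivially. *)
Lemma linear_of_graph (R : pzRingType) (A B : lmodType R)
    (G : A -> B -> Prop) :
  (forall x, exists y, G x y) ->
  (forall r x x' y y', G x y -> G x' y' -> G (r *: x + x') (r *: y + y')) ->
  (forall y, G 0 y -> y = 0) ->
  exists g : {linear A -> B}, forall x y, G x y -> g x = y.
Proof.
move=> Gtot Glin G0; have [g gP] := choice Gtot.
have Guniq x y y' : G x y -> G x y' -> y = y'.
  move=> Gy Gy'; have := Glin (-1) _ _ _ _ Gy Gy'.
  by rewrite !scaleN1r addNr => /G0/eqP; rewrite addrC subr_eq0 => /eqP ->.
have glin : linear g.
  by move=> r x x'; apply: (Guniq (r *: x + x')); [|apply: Glin].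
pose gL : {linear A -> B} :=
  HB.pack g (GRing.isLinear.Build R A B *:%R g glin).
by exists gL => x y; apply: Guniq.
Qed.

(** [R / ann(x + N)], as a model of the cyclic submodule of [M / N] generated
    by the class of [x]. *)
Lemma exists_cyclic (R : pzRingType) (M : lmodType R) (N : set M) (x : M) :
  submodule N -> exists (C : lmodType R) (p : {linear R^o -> C}),
    (forall c, exists r : R, p r = c) /\ forall r : R, p r = 0 <-> N (r *: x).
Proof.
move=> sN; apply: (@exists_quotient R R^o [set r : R | N (r *: x)]).
apply/submoduleP; split=> [|r s t Ns Nt] /=.
  by rewrite scale0r; apply: submodule0.
by rewrite scalerDl -scalerA; apply: submoduleL.
Qed.

(** * V-rings and maximal avoiding submodules *)

Section VRing.
Variable R : pzRingType.

Lemma avoiding_cofull_of_V_ring : left_V_ring R -> avoiding_cofull R.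
Proof.
move=> VR M N x maxN b; have [sN nNx Nmax] := maxN.
have [Q [q [_ qker]]] := exists_quotient sN.
have [C [p [psurj pker]]] := exists_cyclic x sN.
have p1 : p 1 <> 0 by rewrite pker scale1r.
have simpleC : simple_module C.
  split=> [C0|K sK]; first exact/p1/C0.
  have [[c Kc cn0]|K0] := pselect (exists2 c, K c & c <> 0); last first.
    left; rewrite eqEsubset; split=> [c Kc|_ ->]; last exact: submodule0.
    by apply: contrapT => cn0; apply: K0; exists c.
  right; rewrite -subTset => d _.
  have [s ps] := psurj c; have [t <-] := psurj d.
  have nNs : ~ N (s *: x) by rewrite -pker ps.
  have [r Nr] := maximal_avoiding_essential maxN nNs.
  have p1E : p 1 = r *: c.
    apply/eqP; rewrite -subr_eq0 -ps -linearZ -linearB; apply/eqP/pker.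
    by rewrite scalerBl scale1r -scalerA.
  have -> : p t = t *: p 1 by rewrite -linearZ /= [_ *: _]mulr1.
  by rewrite p1E; do 2 apply: (submoduleZ _ sK).
have [j jE] : exists j : {linear C -> Q}, forall r : R, j (p r) = q (r *: x).
  pose G c y := exists2 r : R, p r = c & q (r *: x) = y.
  have [c|r _ _ _ _ [s <- <-] [s' <- <-]|y [s ps <-]|j jG] :=
    @linear_of_graph R C Q G.
  - by have [s <-] := psurj c; exists (q (s *: x)), s.
  - exists (r * s + s'); first by rewrite -linearP.
    by rewrite -linearP scalerDl scalerA.
  - exact/qker/pker.
  - by exists j => r; apply: jG; exists r.
have jinj : injective j.
  move=> c c' /eqP; rewrite -subr_eq0 -linearB => /eqP jcc'.
  apply/eqP; rewrite -subr_eq0; apply/eqP.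
  have [s ps] := psurj (c - c'); move: jcc'; rewrite -ps jE => /qker Ns.
  exact/pker.
have [g gj] := VR C simpleC C Q j idfun jinj.
(* The retraction [g] is injective, as its kernel misses the class of [x]. *)
have kerE : [set m | g (q m) = 0] = N.
  apply: Nmax => [|m Nm|] /=.
  - apply/submoduleP; split=> [|r u v] /=; first by rewrite !linear0.
    by move=> gu gv; rewrite !linearP gu gv scaler0 addr0.
  - by rewrite (qker m).2 // linear0.
  - by rewrite -[x]scale1r -jE gj.
have [s ps] := psurj (g (q b)); exists s.
by rewrite -kerE /= !linearB -jE gj /= ps subrr.
Qed.

Lemma V_ring_of_avoiding_cofull : avoiding_cofull R -> left_V_ring R.
Proof.
move=> cofull S [_ simS] A B i f injI.
have [[a fan0]|f0] := pselect (exists a, f a <> 0); last first.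
  exists \0 => a /=; apply/esym; apply: contrapT => fa.
  by apply: f0; exists a.
pose iker := [set b | exists2 k, f k = 0 & i k = b].
have siker : submodule iker.
  apply/submoduleP; split=> [|r _ _ [k fk <-] [k' fk' <-]].
    by exists 0; rewrite linear0.
  by exists (r *: k + k'); rewrite linearP // fk fk' scaler0 addr0.
have nia : ~ iker (i a) by case=> k fk /injI ka; rewrite -ka in fan0.
have [N kN maxN] := exists_maximal_avoiding siker nia.
have [sN nNia _] := maxN.
pose G b s := exists2 c, N (b - i c) & f c = s.
have [b|r b b' _ _ [c Nc <-] [c' Nc' <-]|_ [c Nc <-]|g gG] :=
  @linear_of_graph R B S G.
- have [s Ns] := cofull _ _ _ maxN b.
  by exists (f (s *: a)), (s *: a); rewrite ?(linearZ_LR i).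
- exists (r *: c + c'); last by rewrite linearP.
  by rewrite linearP opprD addrACA -scalerBr; apply: submoduleL.
- (* If [f c <> 0], then [f a] is a multiple of [f c], which puts [i a] in
     [N + i (ker f) = N]. *)
  apply: contrapT => fcn0.
  have [E|E] := simS _ (submodule_adjoin (f c) (@submodule_set0 R S)).
    apply: fcn0; have := mem_adjoin (f c) (@submodule_set0 R S).
    by rewrite E.
  have [r] : adjoin [set 0] (f c) (f a) by rewrite E.
  rewrite /= -linearZ -linearB => fk; apply: nNia.
  have Nk : N (i (a - r *: c)) by apply: kN; exists (a - r *: c).
  have {}Nc : N (i c).
    by rewrite -[i c]opprK -scaleN1r; apply: submoduleZ; rewrite // -sub0r.
  rewrite -[a](subrK (r *: c)) addrC linearP.
  exact: submoduleL.
- exists g => x; apply: gG; exists x => //.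
  by rewrite subrr; apply: submodule0.
Qed.

(** * Cyclic modules *)

(** A submodule larger than one maximal avoiding the generator is everything, so
    a nonzero cyclic module has a maximal submodule missing the generator. *)
Lemma cyclic_T_rad_zero (C : lmodType R) (c : C) :
  (forall y, exists r, r *: c = y) -> T_rad C -> zero_module C.
Proof.
move=> gen radC; suff c0 : c = 0.
  by move=> y; have [r <-] := gen y; rewrite c0 scaler0.
apply: contrapT => cn0.
have [N _ maxN] := exists_maximal_avoiding (@submodule_set0 R C) cn0.
have [sN nNc _] := maxN; apply: nNc.
have : rad C c by rewrite radC.
apply; apply: (maximal_of_avoiding maxN) => b.
have [r <-] := gen b.
by apply: submoduleZ; [apply: submodule_adjoin|apply: mem_adjoin].
Qed.

Lemma cyclic_co_first (C : lmodType R) (c : C) :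
  (forall y, exists r, r *: c = y) -> rad_co_first C.
Proof.
move=> gen; right=> -[Q [[p psurj] Qn0 radQ]].
apply/Qn0/(@cyclic_T_rad_zero Q (p c)) => // y.
have [x <-] := psurj y; have [r <-] := gen x.
by exists r; rewrite linearZ.
Qed.

Lemma cyclic_rad0 :
  (forall M : lmodType R, Pbar_rad M -> S_rad M) ->
  forall (C : lmodType R) (c : C),
    (forall y, exists r, r *: c = y) -> rad C = [set 0].
Proof.
move=> PS C c gen.
have rad_zero : zero_module C -> rad C = [set 0].
  move=> C0; rewrite eqEsubset; split=> [y _|_ -> N [sN _ _]].
    exact: C0.
  exact: submodule0.
have [/rad_zero //|Cn0] := pselect (zero_module C).
have [|//|[_ [//|radC]]] := PS C.
  by right; split=> //; apply: cyclic_co_first gen.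
exact: rad_zero (cyclic_T_rad_zero gen radC).
Qed.

Lemma avoiding_cofull_of_cyclic_rad0 :
  (forall (C : lmodType R) (c : C),
    (forall y, exists r, r *: c = y) -> rad C = [set 0]) ->
  avoiding_cofull R.
Proof.
move=> crad0 M N x maxN b; have [sN nNx Nmax] := maxN.
have [Nb|nNb] := pselect (N b); first exact: sub_adjoin.
have [r0 Nr0] := maximal_avoiding_essential maxN nNb.
have [C [p [psurj pker]]] := exists_cyclic b sN.
have radC : rad C = [set 0].
  apply: (crad0 C (p 1)) => y; have [r <-] := psurj y.
  by exists r; rewrite -linearZ /= [_ *: _]mulr1.
have pr0 : p r0 <> 0.
  rewrite pker => Nr0b; apply: nNx.
  rewrite -[x](subrK (r0 *: b)) -[x - _]scale1r.
  exact: submoduleL.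
have [L [sL _ Lmax] nLr0] := rad0_nonmem radC pr0.
(* The preimage in [M] of [L], seen inside [M / N]. *)
pose N' := [set m | exists2 l : R, L (p l) & N (m - l *: b)].
have N'E : N' = N.
  apply: Nmax => [|m Nm|[l Ll Nl]].
  - apply/submoduleP; split=> [|r u v [l Ll Nl] [l' Ll' Nl']].
      exists 0; first by rewrite linear0; apply: submodule0.
      by rewrite scale0r subr0; apply: submodule0.
    exists (r * l + l').
      by rewrite [p _](linearP p r l l'); apply: submoduleL.
    rewrite scalerDl -scalerA opprD addrACA -scalerBr.
    exact: submoduleL.
  - exists 0; first by rewrite linear0; apply: submodule0.
    by rewrite scale0r subr0.
  - have /pker : N ((r0 - l) *: b).
      rewrite scalerBl.
      suff -> : r0 *: b - l *: b = (x - l *: b) - (x - r0 *: b).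
        exact: submoduleB.
      by rewrite opprB [RHS]addrC addrA subrK.
    move/eqP; rewrite linearB subr_eq0 => /eqP pr0l.
    by apply: nLr0; rewrite pr0l.
have L0 c : L c -> c = 0.
  have [l <-] := psurj c => Ll; apply/pker.
  by rewrite -N'E; exists l; rewrite // subrr; apply: submodule0.
have [E|E] := Lmax _ (submodule_adjoin (p r0) sL) (@sub_adjoin _ _ L (p r0)).
  by case: nLr0; rewrite -E; apply: mem_adjoin.
have [s] : adjoin L (p r0) (p 1) by rewrite E.
move=> /L0; rewrite -linearZ -linearB => /pker.
rewrite scalerBl scale1r -scalerA => Ns; exists s.
suff -> : b - s *: x = (b - s *: (r0 *: b)) - s *: (x - r0 *: b).
  by apply: submoduleB => //; apply: submoduleZ.
by rewrite scalerBr opprB addrA subrK.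
Qed.

End VRing.

(** * Co-first and second modules *)

Theorem proposition5p7 (R : pzRingType) :
  (forall M : lmodType R, Pbar_rad M <-> S_rad M) <-> left_V_ring R.
Proof.
split=> [PS|/avoiding_cofull_of_V_ring cofull M].
  apply/V_ring_of_avoiding_cofull/avoiding_cofull_of_cyclic_rad0.
  by apply: cyclic_rad0 => M /PS.
have rad0 (Q : lmodType R) := rad_eq0 Q cofull.
have [M0|Mn0] := pselect (zero_module M); first by split=> _; left.
split=> _; right; split=> //; first by left.
right=> -[Q [_ Qn0 radQ]]; apply: Qn0 => y.
have : setT y by [].
by rewrite -radQ rad0.
Qed.
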